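(* Let $\mathcal{X}=(X_1,\dots,X_n)$ be a nonempty weakly uniformly discrete $n$-multiset family satisfying $\psi(\mathcal{X})=\mathcal{X}$ for the data $(A,\mathcal{D}_{ij})$, with primitive subdivision matrix $S=[|\mathcal{D}_{ij}|]_{1\le i,j\le n}$. Then $$\lambda(S)\le|\det(A)|.$$
   Context: Fix integers $d,n\ge 1$, an expanding real $d\times d$ matrix $A$ (all eigenvalues, real or complex, have absolute value $>1$), and finite, possibly empty, sets $\mathcal{D}_{ij}\subset\mathbb{R}^d$ for $1\le i,j\le n$. A multiset $X$ in $\mathbb{R}^d$ is a set $\underline{X}\subset\mathbb{R}^d$ (the underlying set) with a multiplicity function $m_X:\underline{X}\to\mathbb{Z}_{>0}$, extended by $m_X(\mathbf{x})=0$ for $\mathbf{x}\notin\underline{X}$. The multiset union $X\vee Y$ has multiplicity function $m_X+m_Y$. $A(X)$ has multiplicity $m_X(A^{-1}\mathbf{x})$ at $\mathbf{x}$, and $X+\mathcal{D}=\bigvee_{\mathbf{d}\in\mathcal{D}}(X+\mathbf{d})$. An $n$-multiset family is a vector $\mathcal{X}=(X_1,\dots,X_n)$ of multisets in $\mathbb{R}^d$; it is nonempty if some $X_i$ is nonempty. The inflation operator is $\psi(\mathcal{X})=(X_1',\dots,X_n')$ with $X_i'=\bigvee_{j=1}^n(A(X_j)+\mathcal{D}_{ij})$. A multiset $X$ is weakly uniformly discrete if there are $r>0$ and a finite $m\ge1$ such that any open ball of radius $r$ contains at most $m$ points of $X$, counted with multiplicity. A multiset family is weakly uniformly discrete if $\bigvee_{i=1}^nX_i$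 is weakly uniformly discrete (equivalently, each $X_i$ is). A nonnegative real square matrix is primitive if some power has all entries strictly positive; its Perron eigenvalue $\lambda(\cdot)$ is its positive real simple eigenvalue equal to its spectral radius. *)

(* Defs.v *)
From HB Require Import structures.
From mathcomp Require Import all_boot all_order all_algebra.
From mathcomp Require Import finmap complex.
From mathcomp Require Import all_classical all_reals all_analysis.

Set Implicit Arguments.
Unset Strict Implicit.
Unset Printing Implicit Defensive.

Import Order.TTheory GRing.Theory Num.Theory.

Local Open Scope classical_set_scope.
Local Open Scope ring_scope.

(* A real matrix seen as a complex one, so that [eigenvalue] ranges over all
   real and complex eigenvalues. *)
Definition complexify (R : realType) (k : nat) (M : 'M[R]_k) : 'M[R[i]]_k :=
  map_mx (real_complex R) M.

Definition expanding (R : realType) (k : nat) (M : 'M[R]_k) : Prop :=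
  forall z : R[i], eigenvalue (complexify M) z -> 1 < ComplexField.Normc.normc z.

Definition spectral_radius (R : realType) (k : nat) (M : 'M[R]_k) : R :=
  sup [set ComplexField.Normc.normc z | z in [set z | eigenvalue (complexify M) z]].

(* The exponent must be positive: the zeroth power of the 1 x 1 zero matrix has
   a positive entry. *)
Definition primitive_mx (R : realType) (k : nat) (M : 'M[R]_k) : Prop :=
  (forall i j, 0 <= M i j) /\
  exists2 p : nat, (0 < p)%N & forall i j, 0 < (M ^+ p) i j.

(* For primitive M and k > 0, the Perron-Frobenius theorem says that exactly
   one real l satisfies this. Simplicity is algebraic. *)
Definition is_perron_eigenvalue (R : realType) (k : nat) (M : 'M[R]_k) (l : R)
    : Prop :=
  [/\ 0 < l, eigenvalue M l, mup l (char_poly M) = 1%N & l = spectral_radius M].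

(* A multiset is its multiplicity function, extended by 0 off its underlying
   set. *)
Definition multiset (R : realType) (d : nat) : Type := 'cV[R]_d -> nat.

Definition multiset_family (R : realType) (d n : nat) : Type :=
  'I_n -> multiset R d.

Section Multisets.
Variables (R : realType) (d : nat).
Implicit Types (X : multiset R d) (A : 'M[R]_d).

Definition mset_bigunion (n : nat) (F : multiset_family R d n) : multiset R d :=
  fun x => (\sum_(i < n) F i x)%N.

Definition mset_image A X : multiset R d := fun x => X (invmx A *m x).

Definition mset_translate X (v : 'cV[R]_d) : multiset R d := fun x => X (x - v).

Definition mset_add X (D : {fset 'cV[R]_d}) : multiset R d :=
  fun x => (\sum_(v <- D) mset_translate X v x)%N.

Definition inflation (n : nat) A (D : 'I_n -> 'I_n -> {fset 'cV[R]_d})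
    (F : multiset_family R d n) : multiset_family R d n :=
  fun i => mset_bigunion (fun j => mset_add (mset_image A (F j)) (D i j)).

Definition nonempty_family (n : nat) (F : multiset_family R d n) : Prop :=
  exists i, exists x, (0 < F i x)%N.

(* The norm which the library puts on matrices is the sup norm. *)
Definition euclidean_ball (c : 'cV[R]_d) (r : R) : set 'cV[R]_d :=
  [set x | Num.sqrt (\sum_(i < d) (x i 0 - c i 0) ^+ 2) < r].

Definition mset_count X (B : set 'cV[R]_d) : \bar R :=
  \esum_(x in B) ((X x)%:R)%:E.

Definition weakly_uniformly_discrete X : Prop :=
  exists r : R, exists m : nat, [/\ 0 < r, (1 <= m)%N &
    forall c, (mset_count X (euclidean_ball c r) <= (m%:R)%:E)%E].

Definition wud_family (n : nat) (F : multiset_family R d n) : Prop :=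
  weakly_uniformly_discrete (mset_bigunion F).

End Multisets.

Definition subdivision_mx (R : realType) (d n : nat)
    (D : 'I_n -> 'I_n -> {fset 'cV[R]_d}) : 'M[R]_n :=
  \matrix_(i < n, j < n) (#|` D i j|)%:R.

(* Main.v *)
Require Import Defs.
From mathcomp Require Import all_boot all_order all_algebra.
From mathcomp Require Import perm.
From mathcomp Require Import finmap complex.
From mathcomp Require Import all_classical all_reals all_analysis.
From mathcomp Require Import ring lra.

(** Put B = A^-1 and let S be the subdivision matrix. Iterating the fixed point
    equation N times from one point x0 of X_j shows that X_i contains, counted
    with multiplicity, at least (S^N)_ij points of the form
    A^N x0 + sum_(k < N) A^k v_k with digits v_k. As A is expanding, the norms
    of the powers of B have a finite sum ([expanding_summable_inv]), so B^N
    brings all these points to within a distance of x0 that does not depend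
    on N ([fixed_family_mass]).

    On the other hand, the set of all points that B^N maps near x0 has volume
    of order |det A|^N. As B^N is bounded, the balls of a given radius around
    these points lie in a set of the same kind, of comparable volume. A weakly
    uniformly discrete multiset thus puts at most K |det A|^N points in it
    ([wud_mass_le]). Volume does not occur in the proof of this bound:
    it is reduced to counting the integer vectors that a bounded matrix M
    sends into a ball, and an induction on the dimension by Gaussian
    elimination bounds their number by K / |det M|
    ([card_lattice_in_parallelepiped]).

    Hence (S^N)_ij <= K |det A|^N for all N and all i ([subdivision_growth]).
    Primitivity makes every X_j nonempty, so j may be chosen in the support of
    a left eigenvector of S for lambda. This gives lambda^N <= K' |det A|^N for
    all N, and so lambda <= |det A|. *)

Set Implicit Arguments.
Unset Strict Implicit.
Unset Printing Implicit Defensive.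

Import Order.TTheory GRing.Theory Num.Theory.
Local Open Scope ring_scope.

(** * The sup norm of matrices *)

Lemma ler_entry_mx_norm (K : numDomainType) m n (M : 'M[K]_(m, n)) i j :
  `|M i j| <= `|M|.
Proof.
change (`|(M (i, j).1 (i, j).2)| <= mx_norm M).
by rewrite mx_normE -[leLHS]nngE num_le; exact: le_bigmax.
Qed.

Lemma mx_norm_le (K : numDomainType) m n (M : 'M[K]_(m, n)) (b : K) :
  0 <= b -> (forall i j, `|M i j| <= b) -> `|M| <= b.
Proof.
move=> b0 Mb; have [->//|/mx_norm_neq0[ij Mij]] := eqVneq `|M| 0.
by rewrite [leLHS]Mij.
Qed.

Lemma ler_norm_mulmx (K : numDomainType) m n p (M : 'M[K]_(m, n))
    (N : 'M[K]_(n, p)) : `|M *m N| <= n%:R * `|M| * `|N|.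
Proof.
apply: mx_norm_le => [|i j]; first by rewrite !mulr_ge0.
rewrite mxE (le_trans (ler_norm_sum _ _ _))//.
have -> : n%:R * `|M| * `|N| = \sum_(k < n) `|M| * `|N|.
  by rewrite sumr_const card_ord -mulrA mulr_natl.
apply: ler_sum => k _.
by rewrite normrM ler_pM// ler_entry_mx_norm.
Qed.

(** * Summability of the inverse powers of an expanding matrix *)

(** The recurrence gives |z| |u_(k+1)| <= |u_k| + |v_(k+1)|. Summing over k
    bounds (|z| - 1) times the sum of the |u_k| by |z| |u_0| plus the sum of
    the |v_k|. *)
Lemma bounded_sums_peel (K : numFieldType) (V : normedModType K) (z : K)
    (u v : nat -> V) (C : K) :
    1 < `|z| -> (forall k, v k.+1 = u k - z *: u k.+1) ->
    (forall N, \sum_(k < N) `|v k| <= C) ->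
  exists C', forall N, \sum_(k < N) `|u k| <= C'.
Proof.
move=> z1 vE vC; exists ((`|z| * `|u 0| + C) / (`|z| - 1)) => N.
have z10 : 0 < `|z| - 1 by rewrite subr_gt0.
apply: (@le_trans _ _ (\sum_(k < N.+1) `|u k|)).
  by rewrite big_ord_recr /= lerDl.
rewrite ler_pdivlMr//.
have stepk k : `|z| * `|u k.+1| <= `|u k| + `|v k.+1|.
  rewrite -normrZ (_ : z *: u k.+1 = u k - v k.+1) ?ler_normB//.
  by rewrite vE subKr.
have : `|z| * \sum_(k < N) `|u k.+1| <=
       \sum_(k < N) `|u k| + \sum_(k < N) `|v k.+1|.
  by rewrite mulr_sumr -big_split /= ler_sum.
move=> uN; have {uN} : `|z| * \sum_(k < N) `|u k.+1| <=
    \sum_(k < N.+1) `|u k| + C.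
  apply: (le_trans uN); apply: lerD; first by rewrite big_ord_recr /= lerDl.
  by apply: le_trans (vC N.+1); rewrite big_ord_recl lerDr.
set S := \sum_(k < N.+1) _ => uN.
rewrite mulrBr mulr1 lerBlDr -addrA mulrC {1}/S big_ord_recl mulrDr lerD2l.
by rewrite addrC.
Qed.

(** Peeling the factors A - z off the vanishing product one at a time turns
    each sequence A^-k W into one obeying a first-order recurrence with ratio
    1 / z, whose source term is summable by induction. With Cayley-Hamilton,
    this replaces a triangularization of A. *)
Lemma bounded_sums_split_inv (K : numFieldType) d (A : 'M[K]_d.+1) (s : seq K)
    (W : 'M[K]_d.+1) :
    A \in unitmx -> (forall z, z \in s -> 1 < `|z|) ->
    horner_mx A (\prod_(z <- s) ('X - z%:P)) * W = 0 ->
  exists C, forall N, \sum_(k < N) `|A^-1 ^+ k * W| <= C.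
Proof.
move=> Au; elim: s W => [|z s IH] W s1.
  rewrite big_nil rmorph1 mul1r => ->; exists 0 => N.
  by rewrite big1// => k _; rewrite mulr0 normr0.
rewrite big_cons mulrC rmorphM -mulrA rmorphB /= horner_mx_X horner_mx_C.
move=> /IH[|C WC]; first by move=> y ys; apply: s1; rewrite inE ys orbT.
apply: (@bounded_sums_peel _ _ z (fun k => A^-1 ^+ k * W)
  (fun k => A^-1 ^+ k * ((A - z%:M) * W)) C _ _ WC) => [|k].
  by apply: s1; rewrite mem_head.
rewrite mulrBl mulrBr.
congr +%R; first by rewrite exprSr -mulrA mulKr.
by rewrite -[z%:M * W]/(z%:M *m W) mul_scalar_mx -scalerAr.
Qed.

Lemma expanding_unitmx (R : realType) d (A : 'M[R]_d) :
  expanding A -> A \in unitmx.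
Proof.
move=> hA; rewrite unitmxE unitfE; apply/negP => /eqP detA0.
suff /hA : eigenvalue (complexify A) 0 by rewrite Normc.normc0 ltr10.
have /eqP/det0P[v v0 vA] : \det (complexify A) = 0.
  by rewrite det_map_mx detA0 rmorph0.
by apply/eigenvalueP; exists v; rewrite // vA scale0r.
Qed.

(** The complex characteristic polynomial splits, with all its roots of modulus
    greater than 1, and annihilates A. *)
Lemma expanding_summable_inv (R : realType) d (A : 'M[R]_d.+1) :
  expanding A -> exists C, forall N, \sum_(k < N) `|A^-1 ^+ k| <= C.
Proof.
move=> hA; pose Ac := complexify A.
have Au : Ac \in unitmx by rewrite map_unitmx expanding_unitmx.
have [s sE] := closed_field_poly_normal (char_poly Ac).
move: sE; rewrite (monicP (char_poly_monic Ac)) scale1r => sE.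
have [z zs||C CP] := @bounded_sums_split_inv _ d Ac s 1 Au.
- have : eigenvalue Ac z by rewrite eigenvalue_root_char sE root_prod_XsubC.
  by move/hA; rewrite -ltcR.
- by rewrite -sE Cayley_Hamilton mul0r.
exists (complex.Re C) => N; have := CP N; rewrite lecE => /andP[_].
apply: le_trans; rewrite raddf_sum ler_sum//= => k _; rewrite mulr1.
suff : `|A^-1 ^+ k|%:C%C <= `|Ac^-1 ^+ k| by rewrite lecE => /andP[].
have -> : Ac^-1 ^+ k = complexify (A^-1 ^+ k).
  by rewrite /complexify rmorphXn /= map_invmx.
have [->|/mx_norm_neq0[[i j] /= E]] := eqVneq `|A^-1 ^+ k| 0.
  by rewrite normr_ge0.
rewrite [X in X%:C%C]E; have := ler_entry_mx_norm (complexify (A^-1 ^+ k)) i j.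
by apply: le_trans; rewrite mxE normc_def /= expr0n addr0 sqrtr_sqr.
Qed.

(** * Counting lattice points without volume *)

Lemma sum_fibers_le (R : numDomainType) (T U : choiceType) (f : T -> U)
    (A : {fset T}) (w : T -> R) (b : R) :
    (forall y, \sum_(x <- [fset x in A | f x == y]%fset) w x <= b) ->
  \sum_(x <- A) w x <= (#|` [fset f x | x in A]%fset|)%:R * b.
Proof.
move=> fb; rewrite (partition_big_imfset _ f) /=.
apply: (@le_trans _ _ (\sum_(y <- [fset f x | x in A]%fset) b)).
  by apply: ler_sum => y _; rewrite big_fset_condE.
by rewrite big_const_seq count_predT iter_addr_0 mulr_natl.
Qed.

Lemma sum1_fset (R : pzSemiRingType) (T : choiceType) (A : {fset T}) :
  \sum_(x <- A) 1 = (#|` A|)%:R :> R.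
Proof. by rewrite big_const_seq count_predT iter_addr_0. Qed.

Lemma card_int_near (R : realType) (t r : R) (Z : {fset int}) :
    0 <= r -> (forall z, z \in Z -> `|z%:~R - t| <= r) ->
  (#|` Z|)%:R <= 2 * r + 1.
Proof.
move=> r0 Zr; pose a := Num.ceil (t - r); pose n := (Num.truncn (2 * r)).+1.
have r20 : 0 <= 2 * r by rewrite mulr_ge0.
apply: (@le_trans _ _ n%:R); last by rewrite /n -[_.+1%:R]natr1 lerD2r truncn_le.
rewrite ler_nat -(size_iota 0 n) -(size_map (fun k : nat => a + k%:Z)).
apply: uniq_leq_size => // z /Zr; rewrite ler_norml => /andP[z1 z2].
have az : a <= z by rewrite ceil_le_int; lra.
apply/mapP; exists `|z - a|%N; last by rewrite gez0_abs ?subr_ge0//; ring.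
rewrite mem_iota add0n ltnS truncn_ge_nat//.
rewrite -[_%:R]/(`|z - a|%N%:~R) gez0_abs ?subr_ge0// rmorphB /=.
have := ceil_ge (t - r); rewrite -/a; lra.
Qed.

(** This covers submatrices and row permutations at once. *)
Lemma ler_norm_entries (R : numDomainType) m n p q (M : 'M[R]_(m, n))
    (M' : 'M[R]_(p, q)) :
  (forall i j, exists i' j', M' i j = M i' j') -> `|M'| <= `|M|.
Proof.
by move=> MM'; apply: mx_norm_le => // i j; have [i' [j' ->]] := MM' i j;
  exact: ler_entry_mx_norm.
Qed.

(** The Schur complement of the top left entry: what one step of Gaussian
    elimination on the first column leaves below and to the right. *)
Definition schur (F : fieldType) d (M : 'M[F]_(1 + d)) : 'M[F]_d :=
  drsubmx M - ((M 0 0)^-1 *: dlsubmx M) *m ursubmx M.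

Lemma ulsubmx11 (F : fieldType) d (M : 'M[F]_(1 + d)) :
  ulsubmx M = (M 0 0)%:M.
Proof. by rewrite [LHS]mx11_scalar !mxE !lshift0. Qed.

Lemma pivot_col (F : fieldType) d (M : 'M[F]_(1 + d)) :
  M 0 0 != 0 -> ((M 0 0)^-1 *: dlsubmx M) *m ulsubmx M = dlsubmx M.
Proof.
by move=> m0; rewrite ulsubmx11 mul_mx_scalar scalerA divff// scale1r.
Qed.

Lemma det_schur (F : fieldType) d (M : 'M[F]_(1 + d)) :
  M 0 0 != 0 -> \det M = M 0 0 * \det (schur M).
Proof.
move=> m0; set l := (M 0 0)^-1 *: dlsubmx M.
have ME : M = block_mx 1%:M 0 l 1%:M *m
    block_mx (ulsubmx M) (ursubmx M) 0 (schur M).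
  rewrite mulmx_block !mul1mx !mul0mx !addr0 /schur -/l [l *m _ + _]addrC subrK.
  by rewrite pivot_col// submxK.
rewrite {1}ME det_mulmx det_lblock det_ublock !det1 !mul1r ulsubmx11.
by rewrite det_scalar1.
Qed.

(** Row operations on M act in the same way on M x: a bound on M x therefore
    passes to the product of the Schur complement with the tail of x. *)
Lemma schur_mulmx (F : fieldType) d p (M : 'M[F]_(1 + d)) (x : 'M[F]_(1 + d, p)) :
    M 0 0 != 0 ->
  schur M *m dsubmx x =
    dsubmx (M *m x) - ((M 0 0)^-1 *: dlsubmx M) *m usubmx (M *m x).
Proof.
move=> m0; set l := _ *: _.
have -> : M *m x = col_mx (ulsubmx M *m usubmx x + ursubmx M *m dsubmx x)
                          (dlsubmx M *m usubmx x + drsubmx M *m dsubmx x).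
  by rewrite -mul_block_col submxK vsubmxK.
rewrite col_mxKu col_mxKd mulmxDr !mulmxA pivot_col// /schur -/l mulmxBl.
by rewrite opprD addrACA subrr add0r.
Qed.

(** The integer vectors z with M z in the ball of radius rho around c lie in a
    parallelepiped of volume of order 1 / |det M|. As M is bounded, the unit
    cells at these z lie in the same kind of parallelepiped, for a larger rho:
    this is why the number of such z is at most of that order.

    Once the entry of largest modulus in the first column has been moved to the
    top left corner, all the multipliers of the elimination step are at most 1
    in modulus, so that the step at most doubles C and rho. The tails of the
    vectors z then satisfy the same hypotheses for the Schur complement, and
    for a given tail the first coordinate runs through the integers of an
    interval of length 2 rho / |M_00|. *)
Lemma card_lattice_in_parallelepiped (R : realType) d : forall C rho : R,
    0 <= C -> 0 <= rho ->
  exists2 K, 0 <= K & forall (M : 'M[R]_d) (c : 'cV[R]_d) (Z : {fset 'cV[int]_d}),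
    `|M| <= C -> (forall z, z \in Z -> `|M *m map_mx intr z - c| <= rho) ->
    (#|` Z|)%:R * `|\det M| <= K.
Proof.
elim: d => [|d IH] C rho C0 rho0.
  exists 1 => // M c Z _ _; rewrite det_mx00 normr1 mulr1 lern1.
  apply: (@leq_trans #|` [fset 0 : 'cV[int]_0]%fset|); last by rewrite cardfs1.
  apply: fsubset_leq_card.
  by apply/fsubsetP => z _; rewrite inE; apply/eqP/matrixP => -[].
have [K K0 KP] := IH (2 * C) (2 * rho) (mulr_ge0 (ler0n _ 2) C0)
  (mulr_ge0 (ler0n _ 2) rho0).
pose b := 2 * rho + C; have b0 : 0 <= b by rewrite addr_ge0 ?mulr_ge0.
exists (b * K); first exact: mulr_ge0.
move=> M c Z MC MZ.
(* partial pivoting: bring the largest entry of the first column to row 0 *)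
have [i0 _ i0max] := @arg_maxP _ _ _ ord0 xpredT (fun i => `|M i ord0|) isT.
pose s := tperm ord0 i0.
pose M' : 'M[R]_(1 + d) := row_perm s M.
pose c' : 'M[R]_(1 + d, 1) := row_perm s c.
have {i0max} pivot i : `|M' i 0| <= `|M' 0 0|.
  by rewrite !mxE tpermL; apply: i0max.
have M'C : `|M'| <= C.
  apply: le_trans MC; apply: ler_norm_entries => i j.
  by rewrite mxE; exists (s i), j.
have {}MZ z : z \in Z -> `|M' *m map_mx intr z - c'| <= rho.
  move=> /MZ; apply: le_trans; apply: ler_norm_entries => i j.
  exists (s i), j; rewrite /M' row_permE -mulmxA -row_permE.
  by rewrite !mxE.
have -> : `|\det M| = `|\det M'|.
  by rewrite /M' row_permE det_mulmx det_perm normrM normr_sign mul1r.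
move: M' c' pivot M'C MZ => {M c MC s i0} M c pivot MC MZ.
have [m0|m0] := eqVneq (M 0 0) 0.
  suff -> : \det M = 0 by rewrite normr0 mulr0 mulr_ge0.
  rewrite (expand_det_col _ 0) big1// => i _.
  by have := pivot i; rewrite m0 normr0 normr_le0 => /eqP ->; rewrite mul0r.
set l := (M 0 0)^-1 *: dlsubmx M.
have l1 : `|l| <= 1.
  apply: mx_norm_le => // i j; rewrite !mxE (ord1 j) lshift0 normrM normfV.
  by rewrite mulrC ler_pdivrMr ?normr_gt0// mul1r pivot.
have schurC : `|schur M| <= 2 * C.
  rewrite (le_trans (ler_normB _ _))// mulr_natl mulr2n lerD//.
    apply: le_trans MC; apply: ler_norm_entries => i j.
    by rewrite !mxE; do 2 eexists.
  rewrite (le_trans (ler_norm_mulmx _ _))// mul1r.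
  rewrite -[leRHS]mul1r ler_pM//.
  apply: le_trans MC; apply: ler_norm_entries => i j.
  by rewrite !mxE; do 2 eexists.
pose proj (z : 'cV[int]_(1 + d)) : 'cV[int]_d := dsubmx z.
have KZ' : (#|` [fset proj z | z in Z]%fset|)%:R * `|\det (schur M)| <= K.
  apply: (KP _ (dsubmx c - l *m usubmx c)) => // _ /imfsetP[z /= zZ ->].
  pose e := M *m map_mx intr z - c.
  have -> : schur M *m map_mx intr (proj z) - (dsubmx c - l *m usubmx c) =
      dsubmx e - l *m usubmx e.
    rewrite /e /proj map_dsubmx schur_mulmx// -/l.
    rewrite [dsubmx (_ - c)]raddfB [usubmx (_ - c)]raddfB /= mulmxBr.
    by rewrite !opprB addrACA [- _ - _]addrC [RHS]addrACA.
  rewrite (le_trans (ler_normB _ _))// mulr_natl mulr2n lerD//.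
    apply: le_trans (MZ _ zZ); apply: ler_norm_entries => i j.
    by rewrite mxE; do 2 eexists.
  rewrite (le_trans (ler_norm_mulmx _ _))// mul1r.
  rewrite -[leRHS]mul1r ler_pM//.
  apply: le_trans (MZ _ zZ); apply: ler_norm_entries => i j.
  by rewrite mxE; do 2 eexists.
pose first (z : 'cV[int]_(1 + d)) : int := z 0 0.
have fiber y : (#|` [fset z in Z | proj z == y]%fset|)%:R * `|M 0 0| <= b.
  pose r := rho / `|M 0 0|.
  pose t := (M 0 0)^-1 * (c 0 0 - (ursubmx M *m map_mx intr y) 0 0).
  have m0' : 0 < `|M 0 0| by rewrite normr_gt0.
  have zt z : z \in [fset z in Z | proj z == y]%fset ->
      `|(first z)%:~R - t| <= r.
    rewrite !inE => /andP[/MZ zZ /eqP zy].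
    rewrite ler_pdivlMr// mulrC -normrM mulrBr mulrA divff// mul1r.
    have := le_trans (ler_entry_mx_norm _ 0 0) zZ.
    congr (`|_| <= _); rewrite !mxE big_split_ord big_ord1 /= !lshift0 -zy.
    rewrite opprB addrA; congr (_ + _ - _); first by rewrite mxE.
    by apply: eq_bigr => j _; rewrite !mxE lshift0.
  have inj00 : {in [fset z in Z | proj z == y]%fset &, injective first}.
    move=> z1 z2; rewrite !inE => /andP[_ /eqP zy1] /andP[_ /eqP zy2] z00.
    apply/colP => i; case: (split_ordP i) => j ->.
      by rewrite (ord1 j) lshift0.
    by have /colP/(_ j) := etrans zy1 (esym zy2); rewrite !mxE.
  have r0 : 0 <= r by rewrite divr_ge0.
  have imr x : x \in [fset first z | z in [fset z in Z | proj z == y]]%fset ->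
      `|x%:~R - t| <= r.
    by case/imfsetP => z /= /zt ztr ->.
  have := card_int_near r0 imr; rewrite card_in_imfset//= => cardr.
  apply: le_trans (ler_wpM2r (normr_ge0 _) cardr) _.
  (* the 1 of the integer count costs |M_00| <= C after multiplying out *)
  rewrite mulrDl mul1r -mulrA divfK ?gt_eqF// lerD2l.
  by apply: le_trans MC; exact: ler_entry_mx_norm.
rewrite (det_schur m0) normrM.
have Zle : (#|` Z|)%:R <= (#|` [fset proj z | z in Z]%fset|)%:R * (b / `|M 0 0|).
  rewrite -sum1_fset; apply: sum_fibers_le => y.
  by rewrite sum1_fset ler_pdivlMr ?normr_gt0.
apply: (le_trans (ler_wpM2r _ Zle)); first by rewrite -normrM.
have -> : forall k : R, k * (b / `|M 0 0|) * (`|M 0 0| * `|\det (schur M)|) =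
    b * (k * `|\det (schur M)|).
  by move=> k; field; rewrite normr_eq0.
by rewrite ler_wpM2l.
Qed.

(** * Growth of the mass of a fixed family *)

(** Each digit v carries G j injectively into H. Several pairs (j, v) may reach
    the same x in H, but the multiplicities then add up. *)
Lemma inflation_sum_ge (R : realType) d n (A : 'M[R]_d)
    (D : 'I_n -> 'I_n -> {fset 'cV[R]_d}) (X : multiset_family R d n)
    (G : 'I_n -> {fset 'cV[R]_d}) (i : 'I_n) (H : {fset 'cV[R]_d}) :
    A \in unitmx ->
    (forall j y v, y \in G j -> v \in D i j -> A *m y + v \in H) ->
  (\sum_(j < n) #|` D i j| * \sum_(y <- G j) X j y
     <= \sum_(x <- H) inflation A D X i x)%N.
Proof.
move=> Au GH; rewrite /inflation /mset_bigunion /mset_add exchange_big /=.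
apply: leq_sum => j _; rewrite exchange_big /=.
apply: (@leq_trans (\sum_(v <- D i j) \sum_(y <- G j) X j y)).
  by rewrite [leqRHS]big_const_seq count_predT iter_addn_0 mulnC leqnn.
rewrite big_seq [leqRHS]big_seq; apply: leq_sum => v vD.
pose shift y := A *m y + v.
have shift_inj : injective shift.
  by move=> y1 y2 /addIr /(congr1 (mulmx (invmx A))); rewrite !mulKmx.
have -> : (\sum_(y <- G j) X j y =
    \sum_(x <- [fset shift y | y in G j]%fset)
       mset_translate (mset_image A (X j)) v x)%N.
  rewrite big_imfset /=; last by move=> ? ? _ _; exact: shift_inj.
  by apply: eq_bigr => y _; rewrite /mset_translate /mset_image addrK mulKmx.
apply: uniq_sub_le_big => //.
- by move=> a b; exact: leq_addr.
- by move=> x /imfsetP[y /= yG ->]; apply: (GH _ _ _ yG).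
Qed.

(** The N-th power of the inverse brings the N-th generation of descendants of
    x0 back near x0. In one more step A^-(N+1) (A y + v) = A^-N y + A^-(N+1) v,
    so the distance to x0 grows by at most the norm of A^-(N+1) v. The factor
    d + 1 is the dimension, from the bound of the sup norm of a product. *)
Lemma fixed_family_mass (R : realType) d n (A : 'M[R]_d.+1)
    (D : 'I_n -> 'I_n -> {fset 'cV[R]_d.+1}) (X : multiset_family R d.+1 n)
    (delta : R) (j : 'I_n) (x0 : 'cV[R]_d.+1) (N : nat) :
    A \in unitmx -> inflation A D X = X ->
    0 <= delta -> (forall i j v, v \in D i j -> `|v| <= delta) ->
    (0 < X j x0)%N ->
  exists F : 'I_n -> {fset 'cV[R]_d.+1}, forall i,
    (forall x, x \in F i -> `|A^-1 ^+ N *m x - x0| <=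
       \sum_(k < N.+1) d.+1%:R * `|A^-1 ^+ k| * delta) /\
    (subdivision_mx D ^+ N) i j <= (\sum_(x <- F i) X i x)%:R.
Proof.
move=> Au Xfix delta0 Ddelta Xj; elim: N => [|N [F FP]].
  exists (fun i => if i == j then [fset x0]%fset else fset0) => i.
  split=> [x|].
    case: eqP => [_|//]; rewrite inE => /eqP ->.
    rewrite expr0 mul1mx subrr normr0.
    by rewrite sumr_ge0// => k _; rewrite !mulr_ge0.
  by rewrite expr0 mxE; case: eqP => [->|//]; rewrite big_seq_fset1 ler_nat.
pose F' i := (\bigcup_(j' <- enum 'I_n) \bigcup_(v <- D i j')
  [fset (A *m y + v)%R | y in F j'])%fset.
exists F' => i; split.
  move=> x /bigfcupP[j' _ /bigfcupP[v]]; rewrite andbT => vD.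
  case/imfsetP => y /= /(proj1 (FP j')) yF ->{x}.
  rewrite mulmxDr big_ord_recr /= addrAC.
  rewrite (le_trans (ler_normD _ _))// lerD//.
    by rewrite exprSr -mulmxE -mulmxA mulKmx.
  apply: (le_trans (ler_norm_mulmx _ _)).
  by rewrite ler_wpM2l ?mulr_ge0// (Ddelta _ _ _ vD).
rewrite exprS -mulmxE mxE.
have : (\sum_(j' < n) #|` D i j'| * \sum_(y <- F j') X j' y
    <= \sum_(x <- F' i) X i x)%N.
  rewrite -[in X in (_ <= X)%N]Xfix; apply: inflation_sum_ge => // j' y v yF vD.
  apply/bigfcupP; exists j'; first by rewrite mem_enum.
  apply/bigfcupP; exists v; first by rewrite vD.
  by apply/imfsetP; exists y.
rewrite -(ler_nat R); apply: le_trans; rewrite natr_sum ler_sum// => j' _.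
by rewrite natrM mxE ler_wpM2l// (proj2 (FP j')).
Qed.

(** * Weakly uniformly discrete multisets *)

Lemma mset_count_ge_sum (R : realType) d (X : multiset R d)
    (B : set 'cV[R]_d) (F : {fset 'cV[R]_d}) :
    (forall x, x \in F -> B x) ->
  ((\sum_(x <- F) (X x)%:R)%:E <= mset_count X B)%E.
Proof.
move=> FB; apply: esum_ge; exists [set` F]%classic; first by split.
by rewrite -fsbig_seq ?fset_uniq// sumEFin.
Qed.

Lemma floor_cell (R : realType) (x s : R) :
  0 < s -> 0 <= x - s * (Num.floor (x / s))%:~R <= s.
Proof.
move=> s0; have /andP[] := floor_itv (x / s).
rewrite ler_pdivlMr// ltr_pdivrMr// rmorphD /= mulrDl mul1r mulrC => f1 f2.
by rewrite subr_ge0 f1 lerBlDl ltW.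
Qed.

(** The cube of side s = r / (d + 1) has diagonal sqrt d * s < r, so the ball
    around its lowest corner contains it. *)
Lemma cell_in_ball (R : realType) d (r : R) (x : 'cV[R]_d) :
    0 < r -> let s := r / d.+1%:R in
  euclidean_ball (s *: \col_i (Num.floor (x i 0 / s))%:~R) r x.
Proof.
move=> r0 s; have s0 : 0 < s by rewrite divr_gt0.
have rE : r = d.+1%:R * s by rewrite /s mulrC divfK.
rewrite /euclidean_ball /= -[X in _ < X]gtr0_norm// -sqrtr_sqr.
rewrite ltr_sqrt ?exprn_gt0//.
apply: (@le_lt_trans _ _ (\sum_(i < d) s ^+ 2)).
  apply: ler_sum => i _; rewrite !mxE.
  have /andP[f1 f2] := floor_cell (x i 0) s0.
  by rewrite ler_sqr ?nnegrE// ltW.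
rewrite sumr_const card_ord -mulr_natl rE [(_ * s) ^+ 2]exprMn.
rewrite ltr_pM2r ?exprn_gt0//.
by rewrite -natrX ltr_nat expnS expn1 (leq_trans (ltnSn d))// leq_pmulr.
Qed.

(** Cut space into cells of side s, indexed by integer vectors z. A cell has
    mass at most m. If it meets F, then M (s z) is within rho + d C s of c,
    and these z are counted by applying the lattice bound to s M. *)
Lemma wud_mass_le (R : realType) d (X : multiset R d) (C rho : R) :
    weakly_uniformly_discrete X -> 0 <= C -> 0 <= rho ->
  exists2 K, 0 <= K & forall (M : 'M[R]_d) (c : 'cV[R]_d) (F : {fset 'cV[R]_d}),
    `|M| <= C -> (forall x, x \in F -> `|M *m x - c| <= rho) ->
    (\sum_(x <- F) (X x)%:R) * `|\det M| <= K.
Proof.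
move=> [r [m [r0 m1 Xm]]] C0 rho0.
(* cells of side s are small enough to fit in a ball of radius r *)
pose s := r / d.+1%:R; have s0 : 0 < s by rewrite divr_gt0.
have sC0 : 0 <= s * C by rewrite mulr_ge0// ltW.
have rho'0 : 0 <= rho + d%:R * C * s by rewrite addr_ge0 ?mulr_ge0// ltW.
have [K K0 KP] := @card_lattice_in_parallelepiped R d _ _ sC0 rho'0.
exists (m%:R * (K / s ^+ d)).
  by rewrite !mulr_ge0// invr_ge0 exprn_ge0// ltW.
move=> M c F MC MF.
pose cell (x : 'cV[R]_d) : 'cV[int]_d := \col_i Num.floor (x i 0 / s).
have sumF : \sum_(x <- F) (X x)%:R <=
    (#|` [fset cell x | x in F]%fset|)%:R * m%:R :> R.
  apply: sum_fibers_le => z; rewrite -lee_fin.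
  apply: le_trans (Xm (s *: map_mx intr z)); apply: mset_count_ge_sum => x.
  rewrite !inE => /andP[_ /eqP <-].
  rewrite (_ : map_mx _ _ = \col_i (Num.floor (x i 0 / s))%:~R).
    exact: cell_in_ball.
  by apply/colP => i; rewrite !mxE.
have := KP (s *: M) c [fset cell x | x in F]%fset.
rewrite normrZ gtr0_norm// ler_wpM2l ?(ltW s0)// => /(_ isT).
rewrite detZ normrM normrX gtr0_norm// => {}KP.
apply: (le_trans (ler_wpM2r (normr_ge0 _) sumF)).
rewrite mulrAC [leRHS]mulrC ler_wpM2r//.
rewrite ler_pdivlMr ?exprn_gt0// -mulrA [_ * s ^+ d]mulrC.
apply: KP => _ /imfsetP[x /= xF ->].
have -> : s *: M *m map_mx intr (cell x) - c =
    (M *m x - c) - M *m (x - s *: map_mx intr (cell x)).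
  by rewrite mulmxBr -scalemxAl -scalemxAr opprB [RHS]addrC addrA subrK.
rewrite (le_trans (ler_normB _ _))// lerD ?MF//.
rewrite (le_trans (ler_norm_mulmx _ _))// -!mulrA ler_wpM2l// ler_pM//.
apply: mx_norm_le => [|i j]; first exact: ltW.
rewrite !mxE (ord1 j); have /andP[f1 f2] := floor_cell (x i 0) s0.
by rewrite ger0_norm.
Qed.

(** * Comparison of growth rates *)

(** Otherwise (a / b)^N would be unbounded, by Bernoulli's inequality. *)
Lemma geometric_le (R : realType) (a b K : R) :
  0 <= a -> 0 < b -> (forall N, a ^+ N <= K * b ^+ N) -> a <= b.
Proof.
move=> a0 b0 abK; rewrite leNgt; apply/negP => ab.
pose e := a / b - 1; have e0 : 0 < e by rewrite subr_gt0 ltr_pdivlMr ?mul1r.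
have bern N : 1 + e *+ N <= (1 + e) ^+ N.
  elim: N => [|N IH]; first by rewrite mulr0n addr0 expr0.
  rewrite exprS (le_trans _ (ler_wpM2l _ IH))//; last by rewrite addr_ge0// ltW.
  rewrite mulrDr mulr1 mulrDl mul1r mulrS -!addrA !lerD2l.
  by rewrite lerDl mulr_ge0 ?(mulrn_wge0)// ltW.
have eK N : 1 + e *+ N <= K.
  apply: (le_trans (bern N)); rewrite /e addrC subrK expr_div_n.
  by rewrite ler_pdivrMr ?exprn_gt0.
have := eK (Num.truncn (K / e)).+1; rewrite leNgt => /negP; apply.
rewrite -mulr_natl (@lt_trans _ _ (1 + K))// ?ltrDr// ltrD2l.
by rewrite -ltr_pdivrMr// truncnS_gt.
Qed.

Lemma fset_family_bounded (R : realType) d n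
    (D : 'I_n -> 'I_n -> {fset 'cV[R]_d}) :
  exists2 delta : R, 0 <= delta & forall i j v, v \in D i j -> `|v| <= delta.
Proof.
exists (\sum_i \sum_j \sum_(v <- D i j) `|v|).
  by do 3![apply: sumr_ge0 => ? _].
move=> i j v vD.
rewrite (bigD1 i)//= (bigD1 j)//= (big_fsetD1 v)//= -!addrA lerDl.
by rewrite !addr_ge0//; do ![apply: sumr_ge0 => ? _].
Qed.

Lemma subdivision_mxX_ge0 (R : realType) d n
    (D : 'I_n -> 'I_n -> {fset 'cV[R]_d}) (N : nat) i j :
  0 <= (subdivision_mx D ^+ N) i j.
Proof.
elim: N i j => [|N IH] i j; first by rewrite expr0 mxE ler0n.
by rewrite exprS -mulmxE mxE sumr_ge0// => k _; rewrite mulr_ge0// mxE.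
Qed.

(** The N-th generation of a point of X_j has mass at least (S^N)_ij in X_i.
    A^-N sends it to within rho of x0, with rho independent of N, and the
    determinant of A^-N is (det A)^-N. *)
Lemma subdivision_growth (R : realType) d n (A : 'M[R]_d.+1)
    (D : 'I_n -> 'I_n -> {fset 'cV[R]_d.+1}) (X : multiset_family R d.+1 n) :
    expanding A -> wud_family X -> inflation A D X = X ->
  exists K, forall j x0, (0 < X j x0)%N -> forall N i,
    (subdivision_mx D ^+ N) i j <= K * `|\det A| ^+ N.
Proof.
move=> hA Xwud Xfix; have Au := expanding_unitmx hA.
have [C CP] := expanding_summable_inv hA.
have [delta delta0 Ddelta] := fset_family_bounded D.
have C0 : 0 <= C by have := CP 0%N; rewrite big_ord0.
pose rho := d.+1%:R * C * delta.
have rho0 : 0 <= rho by rewrite !mulr_ge0.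
have [K K0 KP] := wud_mass_le Xwud C0 rho0.
exists K => j x0 Xj N i.
have [F /(_ i)[Fnear FS]] := fixed_family_mass N Au Xfix delta0 Ddelta Xj.
have detA0 : 0 < `|\det A| by rewrite normr_gt0 -unitfE -unitmxE.
rewrite -ler_pdivrMr ?exprn_gt0//.
have detAN : `|\det (A^-1 ^+ N)| = (`|\det A| ^+ N)^-1.
  rewrite -exprVn -normfV -normrX; congr `|_|.
  elim: N {Fnear FS F} => [|N IH]; first by rewrite !expr0 det1.
  by rewrite !exprS -mulmxE det_mulmx IH det_inv.
rewrite -detAN.
have : \sum_(x <- F i) (mset_bigunion X x)%:R * `|\det (A^-1 ^+ N)| <= K.
  rewrite -mulr_suml; apply: (KP _ x0) => [|x /Fnear].
    by apply: le_trans (CP N.+1); rewrite big_ord_recr /= lerDr sumr_ge0.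
  move=> /le_trans; apply; rewrite -mulr_suml -mulr_sumr.
  by rewrite ler_wpM2r// ler_wpM2l.
apply: le_trans; rewrite -mulr_suml ler_wpM2r// (le_trans FS)//.
rewrite natr_sum ler_sum// => x _.
by rewrite ler_nat /mset_bigunion (bigD1 i)//= leq_addr.
Qed.

(** If the p-th power of S is positive, then a point of X_j has descendants in
    every X_i after p generations. *)
Lemma fixed_family_nonempty (R : realType) d n (A : 'M[R]_d.+1)
    (D : 'I_n -> 'I_n -> {fset 'cV[R]_d.+1}) (X : multiset_family R d.+1 n) :
    A \in unitmx -> inflation A D X = X -> nonempty_family X ->
    primitive_mx (subdivision_mx D) ->
  forall i, exists x, (0 < X i x)%N.
Proof.
move=> Au Xfix [j [x0 Xj]] [_ [p _ Sp]] i; apply: contrapT => X0.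
have [delta delta0 Ddelta] := fset_family_bounded D.
have [F /(_ i)[_]] := fixed_family_mass p Au Xfix delta0 Ddelta Xj.
apply/negP; rewrite -ltNge big1 ?Sp// => x _; apply/eqP.
by rewrite -leqn0 leqNgt; apply/negP => Xx; apply: X0; exists x.
Qed.

Theorem theorem4p3 (R : realType) (d n : nat) (hd : (1 <= d)%N) (hn : (1 <= n)%N)
    (A : 'M[R]_d) (hA : expanding A)
    (D : 'I_n -> 'I_n -> {fset 'cV[R]_d})
    (X : multiset_family R d n)
    (hX0 : nonempty_family X) (hXwud : wud_family X)
    (hXfix : inflation A D X = X)
    (hS : primitive_mx (subdivision_mx D))
    (lambda : R) (hlambda : is_perron_eigenvalue (subdivision_mx D) lambda) :
  lambda <= `|\det A|.
Proof.
case: d hd A hA D X hX0 hXwud hXfix hS hlambda => // d _ A hA D X X0 Xwud Xfix.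
move=> hS [l0 /eigenvalueP[v vS v0] _ _].
have Au := expanding_unitmx hA; have [K KP] := subdivision_growth hA Xwud Xfix.
have detA0 : 0 < `|\det A| by rewrite normr_gt0 -unitfE -unitmxE.
have /rV0Pn[j vj0] := v0.
(* the column j has to come from a nonempty X_j and from a nonzero entry of v *)
have [x0 Xj] := fixed_family_nonempty Au Xfix X0 hS j.
have vSN N : v *m subdivision_mx D ^+ N = lambda ^+ N *: v.
  elim: N => [|N IH]; first by rewrite !expr0 mulmx1 scale1r.
  by rewrite exprSr -mulmxE mulmxA IH -scalemxAl vS scalerA -exprSr.
apply: (@geometric_le _ _ _ ((\sum_i `|v 0 i|) * K / `|v 0 j|)) => // [|N].
  exact: ltW.
rewrite mulrAC ler_pdivlMr ?normr_gt0//.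
have -> : lambda ^+ N * `|v 0 j| = `|(v *m subdivision_mx D ^+ N) 0 j|.
  by rewrite vSN mxE normrM ger0_norm// exprn_ge0// ltW.
rewrite mxE (le_trans (ler_norm_sum _ _ _))// -mulrA mulr_suml ler_sum// => i _.
by rewrite normrM ler_wpM2l// ger0_norm ?subdivision_mxX_ge0// (KP _ _ Xj).
Qed.
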